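(* Let $A$ be a commutative ring, let $k\ge 1$, let $\vec s=(n_1,\dots,n_k)$ be a tuple of positive integers, and let $n=\min(n_1,\dots,n_k)-1$. Then the diagonal simplicial tensor module $X_\bullet(\vec s;A)$ is a strict algebraic $n$-hypergroupoid if and only if $k=n$.
   Context: Notation: $[p]=\{0,\dots,p\}$. For a shape $\vec s=(n_1,\dots,n_k)$ of positive integers with $n=\min(n_1,\dots,n_k)-1$, put $M_a(p)=n_a-1-n+p$ (so $M_a(p)\ge p$) and $I_p=\prod_{a=1}^k[M_a(p)]$ for $p\ge 0$. Let $\delta_i^q:[q-1]\to[q]$ be the increasing injection missing $i$ and $\sigma_i^q:[q+1]\to[q]$ the nondecreasing surjection taking the value $i$ twice. Define $\Delta_i^p=\prod_{a=1}^k\delta_i^{M_a(p)}:I_{p-1}\to I_p$ ($p\ge1$, $0\le i\le p$) and $\Sigma_i^p=\prod_{a=1}^k\sigma_i^{M_a(p)}:I_{p+1}\to I_p$ ($p\ge 0$, $0\le i\le p$). The diagonal simplicial tensor module $X_\bullet(\vec s;A)$ is the simplicial $A$-module with $X_p=A^{I_p}$ (all functions $T:I_p\to A$), faces $d_i^p(T)=T\circ\Delta_i^p$ and degeneracies $s_i^p(T)=T\circ\Sigma_i^p$. For a simplicial $A$-module $X_\bullet$ and $0\le j\le p$, the horn kernel is the submodule $R_{p,j}(X)=\bigcap_{i\in[p]\setminus\{j\}}\ker(d_i^p:X_p\to X_{p-1})$ of $X_p$ (for $p=0$ the empty intersection is $R_{0,0}(X)=X_0$). A simplicial module $X_\bullet$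 is a strict algebraic $n$-hypergroupoid if (1) $R_{p,j}(X)=0$ for all $p>n$ and all $j$, and (2) $R_{n,j}(X)\ne0$ for at least one $j$.
   Formalization: The commutative ring A is assumed to be nonzero; for the zero ring every X_p is 0, so condition (2) fails and the ''if'' direction is false (e.g. k = 1, shape (2), n = 1). *)

(* Defs.v *)
From HB Require Import structures.
From mathcomp Require Import all_boot all_order all_algebra.
From mathcomp Require Import zify.

Set Implicit Arguments.
Unset Strict Implicit.
Unset Printing Implicit Defensive.

Import GRing.Theory.
Local Open Scope ring_scope.

(* [wid i] and [suc i] send i : 'I_m to i and i + 1 in 'I_m.+1.  They are used *)
(* to state the simplicial identities without truncated indices.              *)
Definition wid m (i : 'I_m) : 'I_m.+1 := widen_ord (leqnSn m) i.
Definition suc m (i : 'I_m) : 'I_m.+1 := lift ord0 i.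

(* [face p i] is d_i^{p+1} : X_{p+1} -> X_p (so i ranges over [p+1]), and      *)
(* [degen p i] is s_i^p : X_p -> X_{p+1} (i ranges over [p]).  With i and j    *)
(* relabelled so that every index is in range, the five groups of identities  *)
(* read d_i d_{j+1} = d_j d_i (i <= j); s_i s_j = s_{j+1} s_i (i <= j);        *)
(* d_i s_{j+1} = s_j d_i (i <= j); d_j s_j = d_{j+1} s_j = id;                 *)
(* d_{i+1} s_j = s_j d_i (j < i).                                             *)
Record simplicialModule (A : comNzRingType) := SimplicialModule {
  smod :> nat -> lmodType A;
  face : forall p, 'I_p.+2 -> {linear smod p.+1 -> smod p};
  degen : forall p, 'I_p.+1 -> {linear smod p -> smod p.+1};
  face_face : forall p (i j : 'I_p.+2) (x : smod p.+2), (i <= j)%N ->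
    face i (face (suc j) x) = face j (face (wid i) x);
  degen_degen : forall p (i j : 'I_p.+1) (x : smod p), (i <= j)%N ->
    degen (wid i) (degen j x) = degen (suc j) (degen i x);
  face_degen_lt : forall p (i : 'I_p.+2) (j : 'I_p.+1) (x : smod p.+1),
    (i <= j)%N -> face (wid i) (degen (suc j) x) = degen j (face i x);
  face_degen_eq : forall p (j : 'I_p.+1) (x : smod p),
    face (wid j) (degen j x) = x;
  face_degen_succ : forall p (j : 'I_p.+1) (x : smod p),
    face (suc j) (degen j x) = x;
  face_degen_gt : forall p (i : 'I_p.+2) (j : 'I_p.+1) (x : smod p.+1),
    (j < i)%N -> face (suc i) (degen (wid j) x) = degen j (face i x)
}.

Arguments face {A} s {p} i.
Arguments degen {A} s {p} i.

Section HornKernel.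
Variables (A : comNzRingType) (X : simplicialModule A).

Definition horn_kernel p : 'I_p.+1 -> {pred X p} :=
  match p return 'I_p.+1 -> {pred X p} with
  | 0 => fun _ => predT
  | q.+1 => fun j => [pred x : X q.+1 | [forall (i | i != j), face X i x == 0]]
  end.

Lemma horn_kernel_submod p (j : 'I_p.+1) : submod_closed (horn_kernel j).
Proof.
case: p j => [|p] j; first by split.
split=> [|a x y]; first by apply/forall_inP => i _; rewrite linear0.
move=> /forall_inP hx /forall_inP hy; apply/forall_inP => i ij.
by rewrite linearP (eqP (hx i ij)) (eqP (hy i ij)) scaler0 addr0.
Qed.

Definition strict_hypergroupoid (n : nat) : Prop :=
  (forall (p : nat) (j : 'I_p.+1), (n < p)%N -> horn_kernel j =i pred1 0) /\
  (exists j : 'I_n.+1, ~ (horn_kernel j =i pred1 0)).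

End HornKernel.

Definition delta q (i : 'I_q.+1) : 'I_q -> 'I_q.+1 := lift i.

Lemma sigma_subproof q (i : 'I_q.+1) (x : 'I_q.+2) : (unbump i x < q.+1)%N.
Proof. by rewrite /unbump; case: i x => i hi [x hx] /=; lia. Qed.

(* [unbump i x] is x - 1 if x > i, and x otherwise. *)
Definition sigma q (i : 'I_q.+1) (x : 'I_q.+2) : 'I_q.+1 :=
  Ordinal (sigma_subproof i x).

Section Shape.
Variables (k : nat) (s : k.-tuple nat).

(* The minimum of the entries of s (for 0 < k). *)
Definition shape_min : nat := \big[minn/head 0%N s]_(m <- s) m.

Lemma shape_min_le a : (shape_min <= tnth s a)%N.
Proof.
rewrite /shape_min; move: (head _ _) => h.
have: tnth s a \in tval s by apply: mem_tnth.
move: (tnth s a) (tval s) => x; elim=> // m t IH.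
rewrite big_cons inE => /orP[/eqP->|/IH]; first exact: geq_minl.
exact: leq_trans (geq_minr _ _).
Qed.

Lemma shape_min_mem : (0 < k)%N -> shape_min \in s.
Proof.
move=> k0; rewrite /shape_min -[_ \in s]/(_ \in tval s).
have hs : head 0%N (tval s) \in tval s.
  by move: (size_tuple s); case: (tval s) => [|m t] /= ks; rewrite ?mem_head //; lia.
rewrite big_seq; apply: (big_ind (fun m => m \in tval s)) => //.
by move=> x y hx hy; rewrite /minn; case: ifP.
Qed.

Definition shape_dim : nat := shape_min.-1.

(* M_a(p) = n_a - 1 - n + p; the subtraction does not truncate, since          *)
(* n <= n_a - 1.  The summand p comes first so that M_a(p+1) is convertible to *)
(* M_a(p) + 1.                                                                *)
Definition shape_M (a : 'I_k) (p : nat) : nat :=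
  (p + (tnth s a - 1 - shape_dim))%N.

Lemma leq_shape_M a p : (p.+1 <= (shape_M a p).+1)%N.
Proof. by rewrite ltnS leq_addr. Qed.

Definition shape_index (p : nat) : finType :=
  {dffun forall a : 'I_k, 'I_(shape_M a p).+1}.

(* i in [p], seen in [M_a(p)]. *)
Definition shape_ord p (i : 'I_p.+1) a : 'I_(shape_M a p).+1 :=
  widen_ord (leq_shape_M a p) i.

Definition Delta p (i : 'I_p.+2) (x : shape_index p) : shape_index p.+1 :=
  [ffun a => delta (shape_ord i a) (x a)].

Definition Sigma p (i : 'I_p.+1) (x : shape_index p.+1) : shape_index p :=
  [ffun a => sigma (shape_ord i a) (x a)].

End Shape.

Section Precomposition.
Variables (A : comNzRingType) (I J : finType) (f : I -> J).

Definition precomp (T : {ffun J -> A^o}) : {ffun I -> A^o} :=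
  [ffun x => T (f x)].

Lemma precomp_linear : linear precomp.
Proof. by move=> a T U; apply/ffunP => x; rewrite !ffunE. Qed.

HB.instance Definition _ := GRing.isLinear.Build A {ffun J -> A^o}
  {ffun I -> A^o} *:%R precomp precomp_linear.

End Precomposition.

Section TensorModule.
Variables (A : comNzRingType) (k : nat) (s : k.-tuple nat).

Definition tensor_mod (p : nat) : lmodType A := {ffun shape_index s p -> A^o}.

Definition tensor_face p (i : 'I_p.+2) :
  {linear tensor_mod p.+1 -> tensor_mod p} := precomp (@Delta k s p i).

Definition tensor_degen p (i : 'I_p.+1) :
  {linear tensor_mod p -> tensor_mod p.+1} := precomp (@Sigma k s p i).

Ltac simplicial :=
  move=> *; apply/ffunP => ?; rewrite !ffunE; congr (fun_of_fin _ _);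
  apply/ffunP => ?; rewrite !ffunE; apply: val_inj;
  rewrite /= /bump /unbump /=;
  move: (nat_of_ord (fun_of_fin _ _)) => y;
  repeat (case: leqP => ? /=); lia.

Fact tensor_face_face p (i j : 'I_p.+2) (x : tensor_mod p.+2) : (i <= j)%N ->
  tensor_face i (tensor_face (suc j) x) =
  tensor_face j (tensor_face (wid i) x).
Proof. simplicial. Qed.

Fact tensor_degen_degen p (i j : 'I_p.+1) (x : tensor_mod p) : (i <= j)%N ->
  tensor_degen (wid i) (tensor_degen j x) =
  tensor_degen (suc j) (tensor_degen i x).
Proof. simplicial. Qed.

Fact tensor_face_degen_lt p (i : 'I_p.+2) (j : 'I_p.+1)
    (x : tensor_mod p.+1) : (i <= j)%N ->
  tensor_face (wid i) (tensor_degen (suc j) x) =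
  tensor_degen j (tensor_face i x).
Proof. simplicial. Qed.

Fact tensor_face_degen_eq p (j : 'I_p.+1) (x : tensor_mod p) :
  tensor_face (wid j) (tensor_degen j x) = x.
Proof. simplicial. Qed.

Fact tensor_face_degen_succ p (j : 'I_p.+1) (x : tensor_mod p) :
  tensor_face (suc j) (tensor_degen j x) = x.
Proof. simplicial. Qed.

Fact tensor_face_degen_gt p (i : 'I_p.+2) (j : 'I_p.+1)
    (x : tensor_mod p.+1) : (j < i)%N ->
  tensor_face (suc i) (tensor_degen (wid j) x) =
  tensor_degen j (tensor_face i x).
Proof. simplicial. Qed.

Definition tensor_module : simplicialModule A :=
  SimplicialModule tensor_face_face tensor_degen_degen tensor_face_degen_lt
    tensor_face_degen_eq tensor_face_degen_succ tensor_face_degen_gt.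

End TensorModule.

(* Main.v *)
Require Import Defs.
From mathcomp Require Import all_boot all_order all_algebra.

(* A tensor lies in R_{p,j} exactly when it vanishes at every multi-index that  *)
(* misses some value i <> j of [p].  The k entries of a multi-index cover       *)
(* [p] \ {j} for a suitable multi-index if and only if p <= k, so R_{p,j} is    *)
(* zero if and only if k < p, independently of j.                               *)

Import GRing.Theory.
Local Open Scope ring_scope.

(** The image of [Delta i] consists of the multi-indices with no entry equal to [i] ([Delta_neq],
    [Delta_surj_avoid]), so [tensor_horn_kernel_eq0] reduces to counting. Vanishing in all degrees
    above n then means k <= n, and a nonzero horn kernel in degree n means n <= k. *)

Section HornKernelTensor.
Variables (A : comNzRingType) (k : nat) (s : k.-tuple nat).

Lemma Delta_neq p (i : 'I_p.+2) (y : shape_index s p) a :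
  Delta i y a != shape_ord s i a.
Proof. by rewrite ffunE eq_sym; apply: neq_lift. Qed.

Lemma Delta_surj_avoid p (i : 'I_p.+2) (x : shape_index s p.+1) :
  (forall a, x a != shape_ord s i a) -> exists y, x = Delta i y.
Proof.
move=> xi; exists [ffun a => odflt ord0 (unlift (shape_ord s i a) (x a))].
apply/ffunP => a; rewrite !ffunE /delta.
case: unliftP => [z //|xE].
by have := xi a; rewrite xE eqxx.
Qed.

(** Pigeonhole: [j] and the k entries occupy at most k + 1 <= p of the p + 1 values. *)
Lemma exists_avoided_value p (j : 'I_p.+1) (x : shape_index s p) :
  (k < p)%N -> exists2 i, i != j & forall a, x a != shape_ord s i a.
Proof.
(* Entries may exceed p; [inord] sends those to 0, which at worst enlarges [used]. *)
move=> kp; pose used := j |: [set inord (x a) | a : 'I_k].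
have : (#|used| < #|'I_p.+1|)%N.
  rewrite card_ord ltnS (leq_trans _ kp) // (leq_trans (leq_card_setU _ _)) //.
  by rewrite cards1 add1n ltnS (leq_trans (leq_imset_card _ _)) // card_ord.
rewrite ltnNge => /negP usedN.
have [i iN] : exists i, i \notin used.
  apply/existsP; apply: contra_notT usedN => /existsPn all_used.
  by apply/subset_leq_card/subsetP => i _; have := all_used i; rewrite negbK.
exists i; first by apply: contraNneq iN => ->; rewrite setU11.
move=> a; apply: contraNneq iN => xa.
by rewrite !inE; apply/orP; right; apply/imsetP; exists a; rewrite // xa inord_val.
Qed.

Lemma exists_covering_index p (j : 'I_p.+1) : (p <= k)%N ->
  exists x : shape_index s p, forall i, i != j -> exists a, x a = shape_ord s i a.
Proof.
case: p j => [|p] j pk.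
  by exists [ffun=> ord0] => i; rewrite (ord1 i) (ord1 j) eqxx.
(* The first axes enumerate the values other than [j]; on the remaining axes [inord] defaults to 0,
   which is harmless. *)
exists [ffun a : 'I_k => shape_ord s (lift j (inord a)) a] => i.
rewrite eq_sym => /unlift_some [i' -> _].
by exists (widen_ord pk i'); rewrite ffunE inord_val.
Qed.

Lemma tensor_horn_kernel_eq0 p (j : 'I_p.+1) :
  @horn_kernel A (tensor_module A s) p j =i pred1 0 <-> (k < p)%N.
Proof.
split=> [ker0|kp T].
  rewrite ltnNge; apply/negP => pk.
  have [x xP] := exists_covering_index p j pk.
  (* The indicator of a covering index restricts to zero along each [Delta i] with [i != j]. *)
  pose T : tensor_module A s p := [ffun y => (y == x)%:R].
  have: T \in horn_kernel j.
    case: p j pk ker0 x xP @T => [//|p] j _ _ x xP /=.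
    apply/forall_inP => i /xP[a xa]; apply/eqP/ffunP => y; rewrite !ffunE.
    by case: eqP => // yx; have := Delta_neq p i y a; rewrite yx xa eqxx.
  rewrite ker0 => /eqP/ffunP/(_ x); rewrite !ffunE eqxx => /eqP.
  by rewrite oner_eq0.
case: p j kp T => [//|p] j kp T; apply/idP/eqP => [/forall_inP TP|->].
  apply/ffunP => x; have [i ij /Delta_surj_avoid[y ->]] := exists_avoided_value _ j x kp.
  by have /eqP/ffunP/(_ y) := TP i ij; rewrite !ffunE.
by apply/forall_inP => i _; rewrite linear0.
Qed.

End HornKernelTensor.

Theorem theorem5p3 (A : comNzRingType) (k : nat) (s : k.-tuple nat)
    (k_gt0 : (0 < k)%N) (s_gt0 : forall a : 'I_k, (0 < tnth s a)%N) :
  strict_hypergroupoid (tensor_module A s) (shape_dim s) <-> k = shape_dim s.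
Proof.
set n := shape_dim s; split=> [[ker0 [j /tensor_horn_kernel_eq0/negP]]|kn].
  rewrite -leqNgt => nk; apply/eqP; rewrite eqn_leq nk andbT leqNgt.
  (* If n < k, vanishing in degree k itself would give k < k. *)
  by apply/negP => /(ker0 _ ord0)/tensor_horn_kernel_eq0; rewrite ltnn.
split=> [p j np|]; first by apply/tensor_horn_kernel_eq0; rewrite kn.
by exists ord0 => /tensor_horn_kernel_eq0; rewrite kn ltnn.
Qed.
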